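(* Let $k_0\ge 3$ be an integer and $\lambda>0$. Consider the random walk on the growing complete graph with parameters $k_0$ and $\lambda$ (defined in the context), started at $v_1$. For an integer $T\ge1$ let $N_T$ be the number of vertices visited at least once by the walker up to time $T$, and for $2\le j\le k_0+T-1$ let $A_j=A_j(T)$ be the event that the vertex $v_j$ is not visited by the walker up to time $T$. Write $\mathcal{H}(n)=\sum_{i=1}^n\frac1i$ and $$u_j=u_j(T)=\begin{cases}1-e^{-\lambda(\mathcal{H}(k_0+T-2)-\mathcal{H}(k_0-2))}, & 2\le j\le k_0,\\ 1-e^{-\lambda(\mathcal{H}(k_0+T-2)-\mathcal{H}(j-2))}, & k_0+1\le j\le k_0+T-1.\end{cases}$$ Then: (i) For all $2\le r<s\le k_0+T-1$, the events $A_r$ and $A_s$ are independent. (ii) $\mathrm{Var}(N_T)=\sum_{j=2}^{k_0+T-1}(1-u_j)u_j$. (iii) As $T\to\infty$, $\mathrm{Var}(N_T)\sim\dfrac{\lambda}{(\lambda+1)(2\lambda+1)}\,T$, i.e. the ratio of the two sides tends to $1$.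
   Context: Model (random walk on the growing complete graph). At time $0$ there are $k_0\ge 3$ vertices $v_1,\dots,v_{k_0}$ forming a complete graph, and a walker sits at $v_1$. For each $t\in\{1,2,\dots\}$, a new vertex $v_{k_0+t}$ is created at time $t$ and joined to all present vertices; thus during the time interval $[t-1,t)$ the graph is the complete graph on $v_1,\dots,v_{k_0+t-1}$. The walker moves at random times: the times between successive moves (and up to the first move) are i.i.d. exponential with mean $1/\lambda$, so the move times form a Poisson process of rate $\lambda$; in particular the numbers $M_t$ of moves in $[t-1,t)$, $t\ge1$, are independent Poisson random variables with parameter $\lambda$. At each move the walker jumps to a vertex chosen uniformly at random among the vertices present at that time other than her current vertex, independently of the move times and of the past given her current position. The starting vertex counts as visited. *)

(* Defs.v *)
From HB Require Import structures.
From mathcomp Require Import all_boot all_order all_algebra.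
From mathcomp Require Import finmap.
From mathcomp Require Import all_classical all_reals all_analysis.
Set Implicit Arguments.
Unset Strict Implicit.
Unset Printing Implicit Defensive.
Import Order.TTheory GRing.Theory Num.Theory.
Import numFieldNormedType.Exports.
Local Open Scope classical_set_scope.
Local Open Scope ring_scope.

Definition independent_events d (Omega : measurableType d) (R : realType)
    (P : probability Omega R) (A B : set Omega) : Prop :=
  P (A `&` B) = (P A * P B)%E.

Definition mutually_independent d (Omega : measurableType d) (R : realType)
    (P : probability Omega R) (xi : nat -> {RV P >-> R}) : Prop :=
  forall (F : {fset nat}) (B : nat -> set R),
    (forall i, measurable (B i)) ->
    P (\bigcap_(i in [set` F]) (xi i @^-1` B i))
      = (\prod_(i <- F) P (xi i @^-1` B i))%E.

Section Walk.
Context d (Omega : measurableType d) (R : realType) (P : probability Omega R).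
Variables (k0 : nat) (xi : nat -> {RV P >-> R}) (X : nat -> {RV P >-> nat}).

(* The vertex v_j is represented by the number j >= 1. On [t-1, t) the vertices
   are v_1, ..., v_{k0+t-1}; a vertex created at an integer time is present
   from that time on. *)
Definition vertices (s : R) : seq nat := iota 1 (k0 + Num.truncn s).

(* Time of the n-th move: xi i is the time between the i-th and the (i+1)-st
   move, and the 0-th move stands for the start at time 0. *)
Definition move_time (n : nat) (w : Omega) : R := \sum_(i < n) xi i w.

Definition targets (s : R) (x : nat) : seq nat :=
  [seq z <- vertices s | z != x].

Definition jump_prob (s : R) (x y : nat) : R :=
  (y \in targets s x)%:R / (size (targets s x))%:R.

(* The sigma-algebra generated by all the move times and by the first n+1
   positions of the walker. *)
Definition past (n : nat) : set (set Omega) :=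
  <<s \bigcup_i preimage_set_system setT (xi i) measurable `|`
      \bigcup_(m in [set m | (m <= n)%N])
        preimage_set_system setT (X m) measurable >>.

(* X n is the walker's position just after the n-th move. The last field says
   that, for every y, the random variable
   w |-> jump_prob (move_time n.+1 w) (X n w) y is a version of the conditional
   probability P(X_{n+1} = y | past n). *)
Record growing_complete_walk (lambda : R) : Prop := GrowingCompleteWalk {
  holding_independent : mutually_independent xi;
  holding_exponential : forall i (B : set R), measurable B ->
    distribution P (xi i) B = exponential_prob lambda B;
  walk_start : forall w, X 0%N w = 1%N;
  walk_jump : forall n y (B : set Omega), past n B ->
    P (B `&` [set w | X n.+1 w = y])
      = (\int[P]_(w in B) (jump_prob (move_time n.+1 w) (X n w) y)%:E)%E
}.

(* The walker sits at X n w during [move_time n w, move_time n.+1 w). *)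
Definition visited (s : R) (j : nat) (w : Omega) : Prop :=
  exists n, move_time n w <= s /\ X n w = j.

Definition unvisited (T j : nat) : set Omega :=
  [set w | ~ visited T%:R j w].

Definition num_visited (T : nat) (w : Omega) : R :=
  (count (fun j => `[< visited T%:R j w >]) (vertices T%:R))%:R.

End Walk.

Definition harmonic_number (R : realType) (n : nat) : R :=
  \sum_(1 <= i < n.+1) i%:R^-1.

Definition visit_prob (R : realType) (k0 : nat) (lambda : R) (T j : nat) : R :=
  if (j <= k0)%N then
    1 - expR (- (lambda * (harmonic_number R (k0 + T - 2)
                           - harmonic_number R (k0 - 2))))
  else
    1 - expR (- (lambda * (harmonic_number R (k0 + T - 2)
                           - harmonic_number R (j - 2)))).

(* Main.v *)
(* For a set S of at most two vertices other than v_1, the walk avoids S up to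
   time T with probability exp(-lambda * sum_{k<T} q_k), where q_k is the
   probability that a jump in [k, k+1) from outside S leads into S: conditionally
   on the move times tau_1 < tau_2 < ..., each move up to time T misses S with
   probability 1 - q, and the moves form a Poisson process.  The Poisson
   functional is computed from the exponential holding times alone: with
   g(s) = exp(-lambda * int_s^T q), the product of prod_{i<=n} (1 - q(tau_i)) and
   g(tau_n) is a martingale, g being a fixed point of the renewal equation.

   Since q_k is additive in S, the events A_r and A_s are independent, and the
   variance is that of a sum of pairwise independent indicators.

   For the asymptotics, let B_T(mu) be the sum of 1 - u_j over 2 <= j <= k0+T for
   the rate mu.  Then Var(N_T) = B_T(lambda) - B_T(2 lambda), and
   B_{T+1}(mu) = exp(-mu/(k0+T-1)) B_T(mu) + 1, whence B_T(mu)/T -> 1/(mu+1). *)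

Require Import Defs.
From HB Require Import structures.
From mathcomp Require Import all_boot all_order all_algebra.
From mathcomp Require Import finmap.
From mathcomp Require Import all_classical all_reals all_analysis.
From mathcomp Require Import measurable_realfun.
From mathcomp Require Import ring lra zify.
Set Implicit Arguments.
Unset Strict Implicit.
Unset Printing Implicit Defensive.
Import Order.TTheory GRing.Theory Num.Theory.
Import numFieldNormedType.Exports.
Local Open Scope classical_set_scope.
Local Open Scope ring_scope.

(** * Measurability of the integer part, and integration against a density *)

Lemma measurable_truncn (R : realType) :
  measurable_fun [set: R] (@Num.truncn R).
Proof.
have mS k : measurable [set s : R | (k < Num.truncn s)%N].
  rewrite (_ : [set _ | _] = `[k.+1%:R, +oo[%classic); first exact: measurable_itv.
  by apply/seteqP; split=> s /=; rewrite in_itv/= andbT ltnNge truncn_le_nat -leNgt.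
move=> _ A _; rewrite setTI.
rewrite (_ : _ @^-1` _ = \bigcup_(k in A) [set s : R | Num.truncn s = k]); last first.
  by apply/seteqP; split=> [s /= As|s [k Ak /= ->]//]; exists (Num.truncn s).
apply: bigcup_measurable => -[|k] _.
  (* The fibre over 0 also contains the negative reals, where [Num.truncn] is 0. *)
  rewrite (_ : [set _ | _] = ~` [set s : R | (0 < Num.truncn s)%N]); first exact: measurableC.
  by apply/seteqP; split=> s /=; lia.
rewrite (_ : [set _ | _] = [set s : R | (k < Num.truncn s)%N] `\` [set s : R | (k.+1 < Num.truncn s)%N]); first exact: measurableD.
by apply/seteqP; split=> s /=; lia.
Qed.

(** Since [nu] is dominated by [mu], it has a Radon-Nikodym derivative; [p] equals it almost
    everywhere because both integrate to [nu] over every measurable set. *)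
Lemma ge0_integral_density d (T : measurableType d) (R : realType)
    (mu : {sigma_finite_measure set T -> \bar R})
    (nu : {finite_measure set T -> \bar R}) (p : T -> \bar R) (f : T -> \bar R) :
  measurable_fun setT p ->
  (forall A, measurable A -> nu A = \int[mu]_(x in A) p x)%E ->
  measurable_fun setT f -> (forall x, 0 <= f x)%E ->
  (\int[nu]_x f x = \int[mu]_x (f x * p x))%E.
Proof.
move=> mp nup mf f0.
have numu : nu `<< mu.
  move=> A A0 B mB BA; have B0 := A0 _ mB BA.
  rewrite nup// null_set_integral//; exact: measurable_funTS.
rewrite -(Radon_Nikodym_SigmaFinite.change_of_variables numu)//.
have mrn := measurable_int _ (Radon_Nikodym_SigmaFinite.f_integrable numu).
apply: ae_eq_integral => //; [exact: emeasurable_funM|exact: emeasurable_funM|].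
apply: ae_eqe_mul2l; apply: integral_ae_eq => //.
  exact: Radon_Nikodym_SigmaFinite.f_integrable.
move=> E _ mE.
by rewrite -(Radon_Nikodym_SigmaFinite.f_integral numu)// nup.
Qed.

(** * Killing at the points of a Poisson process *)

Section kill.
Context (R : realType) (lambda : R) (q : nat -> R) (T : nat).

(* If a particle is killed at each move with probability [kill_prob] of the move time, and
   moves occur at rate [lambda], [survival s] is its chance of outliving [s, T]. *)
Definition kill_prob (s : R) : R := if s <= T%:R then q (Num.truncn s) else 0.

Definition survival (s : R) : R :=
  expR (- (lambda * \sum_(k < T) q k * Num.min 1 (Num.max 0 (k.+1%:R - s)))).

Lemma measurable_kill_prob : measurable_fun [set: R] kill_prob.
Proof.
apply: measurable_fun_ifT => //; first exact: measurable_fun_ler.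
by apply: measurableT_comp => //; exact: measurable_truncn.
Qed.

Lemma measurable_survival : measurable_fun [set: R] survival.
Proof.
apply: measurableT_comp => //; apply: measurable_funN; apply: measurable_funM => //.
apply: measurable_sum => k; apply: measurable_funM => //.
apply: measurable_minr => //; apply: measurable_maxr => //.
exact: measurable_funB.
Qed.

Lemma survival_gt0 s : 0 < survival s. Proof. exact: expR_gt0. Qed.

Lemma survival_eq1 s : T%:R <= s -> survival s = 1.
Proof.
move=> Ts; rewrite /survival big1 ?mulr0 ?oppr0 ?expR0// => k _.
have : k.+1%:R <= T%:R :> R by rewrite ler_nat.
move=> kT; rewrite max_l ?min_r ?mulr0//; lra.
Qed.

Lemma survival0 : survival 0 = expR (- (lambda * \sum_(k < T) q k)).
Proof.
rewrite /survival; congr (expR (- (_ * _))); apply: eq_bigr => k _.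
have : 1 <= k.+1%:R :> R by rewrite ler1n.
by move=> k1; rewrite subr0 max_r ?min_l ?mulr1//; lra.
Qed.

(** The clamped factor in [survival] is the length of the part of [i, i+1] lying after s. For s in
    [k, k+1] it is 0 for i < k and 1 for i > k, so only the k-th term varies with s. *)
Lemma survival_cell (k : nat) s : (k < T)%N -> k%:R <= s <= k.+1%:R ->
  survival s = expR (- (lambda * q k * (k.+1%:R - s))) * survival k.+1%:R.
Proof.
move=> kT /andP[ks sk]; rewrite /survival -expRD; congr expR.
rewrite -opprD -mulrA -mulrDr; congr (- (_ * _)).
rewrite (bigD1 (Ordinal kT))//= [in RHS](bigD1 (Ordinal kT))//= addrA; congr (_ + _).
  rewrite subrr maxxx [Num.min 1 0]min_r// mulr0 addr0 max_r ?subr_ge0// min_r//.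
  by move: sk; rewrite -natr1; lra.
apply: eq_bigr => i ik; congr (_ * _).
have [ki|ki|ki] := ltngtP i k.
- have : i.+1%:R <= k%:R :> R by rewrite ler_nat.
  move=> ?; have ? : k%:R <= k.+1%:R :> R by rewrite ler_nat.
  by rewrite !max_l//; lra.
- have : k.+2%:R <= i.+1%:R :> R by rewrite ler_nat.
  rewrite -[k.+2%:R]natr1 => ?.
  have i1 : 1 <= i.+1%:R - k.+1%:R :> R by lra.
  rewrite !max_r ?min_l//; lra.
- by move/eqP : ik; case; exact/val_inj.
Qed.

End kill.

Lemma is_derive_expRM (R : realType) (m x : R) :
  is_derive x 1 (fun x : R => - expR (- (m * x))) (m * expR (- (m * x))).
Proof. by apply: is_derive_eq; rewrite /GRing.scale/=; ring. Qed.

Lemma continuous_expRM (R : realType) (m : R) :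
  continuous (fun x : R => expR (- (m * x))).
Proof.
move=> x; apply: differentiable_continuous; apply/derivable1_diffP.
exact: ex_derive.
Qed.

(** The rate [m] is arbitrary because the value lambda * (1 - q k) taken below vanishes when q k =
    1. *)
Lemma integral_expR_itv (R : realType) (m a b : R) : a <= b ->
  (\int[lebesgue_measure]_(x in `[a, b]) (m * expR (- (m * x)))%:E
   = (expR (- (m * a)) - expR (- (m * b)))%:E)%E.
Proof.
rewrite le_eqVlt => /predU1P[->|ab].
  by rewrite subrr set_itv1 integral_set1.
rewrite (@continuous_FTC2 _ _ (fun x => - expR (- (m * x))))//.
- by rewrite -EFinB; congr EFin; ring.
- apply: continuous_subspaceT => x; apply: cvgMl_tmp; exact: continuous_expRM.
- split.
  + by move=> x _; have [] := is_derive_expRM m x.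
  + by apply: cvg_at_right_filter; apply: cvgN; exact: continuous_expRM.
  + by apply: cvg_at_left_filter; apply: cvgN; exact: continuous_expRM.
- by move=> x _; rewrite derive1E; have [] := is_derive_expRM m x.
Qed.

Lemma integral_expR_itvy (R : realType) (m a : R) : 0 < m ->
  (\int[lebesgue_measure]_(x in `[a, +oo[) (m * expR (- (m * x)))%:E
   = (expR (- (m * a)))%:E)%E.
Proof.
move=> m0.
rewrite (@ge0_continuous_FTC2y _ _ (fun x => - expR (- (m * x))) _ 0)//.
- by rewrite -EFinB; congr EFin; ring.
- by move=> x _; rewrite mulr_ge0 ?expR_ge0 ?ltW.
- apply: continuous_subspaceT => x; apply: cvgMl_tmp; exact: continuous_expRM.
- rewrite -oppr0; apply: cvgN.
  rewrite (_ : (fun x => expR (- (m * x))) = (fun z => expR (- z)) \o (fun z => m * z))//.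
  apply: (@cvg_comp _ _ _ _ _ _ (pinfty_nbhs R)); last exact: cvgr_expR.
  exact: gt0_cvgMry.
- by apply: cvg_at_right_filter; apply: cvgN; exact: continuous_expRM.
- by move=> x _; rewrite derive1E; have [] := is_derive_expRM m x.
Qed.

Section exponential_survival.
Context (R : realType) (lambda : R) (q : nat -> R) (T : nat).
Hypotheses (lambda0 : 0 < lambda) (q1 : forall k, q k <= 1).

Local Notation kill := (kill_prob q T).
Local Notation surv := (survival lambda q T).

Lemma kill_prob_le1 s : kill s <= 1.
Proof. by rewrite /kill_prob; case: ifPn. Qed.

Let h (s : R) := (1 - kill s) * surv s.

Let mh (t : R) : measurable_fun [set: R] (fun y => h (t + y) * (lambda * expR (- (lambda * y)))).
Proof.
apply: measurable_funM.
  apply: (measurableT_comp (f := h)); last exact: measurable_funD.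
  apply: measurable_funM; last exact: measurable_survival.
  by apply: measurable_funB => //; exact: measurable_kill_prob.
apply: measurable_funM => //; apply: measurableT_comp => //.
by apply: measurable_funN; exact: measurable_funM.
Qed.

Let h0 t y : 0 <= h (t + y) * (lambda * expR (- (lambda * y))).
Proof.
rewrite mulr_ge0// mulr_ge0 ?expR_ge0 ?(ltW lambda0)// ?subr_ge0 ?kill_prob_le1//.
Qed.

(** For b >= t, there is no move in [t, b) with probability exp(-lambda * (b - t)), and survival
    then starts afresh from b. Varying b with t fixed is what allows an induction. *)
Lemma integral_survivaly (t b : R) : 0 <= b ->
  (\int[lebesgue_measure]_(y in `[(b - t)%R, +oo[)
     (h (t + y) * (lambda * expR (- (lambda * y))))%:E
   = (expR (- (lambda * (b - t))) * surv b)%:E)%E.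
Proof.
(* Downward induction over the unit intervals, on which the rate is constant. *)
have [n] := ubnP (T - Num.truncn b)%N; elim: n b => // n IH b bn b0.
(* The left endpoint is dropped because [kill_prob] still takes the value q T at time T, which
   matters when b = T. *)
rewrite -integral_itv_obnd_cbnd; last exact/measurable_EFinP/measurable_funTS.
have [Tb|bT] := leP T%:R b.
  rewrite survival_eq1// mulr1 -integral_expR_itvy// -integral_itv_obnd_cbnd; last first.
    apply/measurable_EFinP/measurable_funTS; apply: measurable_funM => //; apply: measurableT_comp => //.
    by apply: measurable_funN; exact: measurable_funM.
  apply: eq_integral => y; rewrite inE/= in_itv/= andbT => yb.
  rewrite /h survival_eq1; last by lra.
  by rewrite /kill_prob ifF ?subr0 ?mul1r//; apply/negbTE; rewrite -ltNge; lra.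
pose k := Num.truncn b; rewrite -/k in bn.
have [kb bk] : k%:R <= b /\ b < k.+1%:R by apply/andP; exact: trunc_itv.
have kT : (k < T)%N by rewrite -(ltr_nat R); lra.
have mI A : measurable_fun A (fun y => (h (t + y) * (lambda * expR (- (lambda * y))))%:E).
  exact/measurable_EFinP/measurable_funTS.
rewrite (@itv_bndbnd_setU _ _ _ (BLeft (k.+1%:R - t)))//; last first.
  by rewrite bnd_simp; lra.
have dI : [disjoint `](b - t), (k.+1%:R - t)[%classic & `[(k.+1%:R - t), +oo[%classic].
  rewrite disj_set2E; apply/eqP/seteqP; split=> // y []/=; rewrite !in_itv/= andbT; lra.
rewrite ge0_integral_setU// {dI}; last by move=> y _; rewrite lee_fin.
rewrite IH//; last first.
  by rewrite (@truncn_def _ _ k.+1) ?lexx ?ltr_nat//; lia.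
rewrite (_ : \int[_]_(x in _) _ = (expR (- (lambda * (b - t))) * surv b - expR (- (lambda * (k.+1%:R - t))) * surv k.+1%:R)%:E)%E.
  by rewrite -EFinD; congr EFin; ring.
rewrite [surv b](survival_cell lambda q kT); last by lra.
(* On this interval the integrand is m * exp(-m * y) with m = lambda * (1 - q k), times the constant
   [D] that collects the factors free of y. *)
pose D := surv k.+1%:R * expR (- (lambda * q k * (k.+1%:R - t))).
transitivity (\int[lebesgue_measure]_(y in `[(b - t)%R, (k.+1%:R - t)%R]) (D%:E * (lambda * (1 - q k) * expR (- (lambda * (1 - q k) * y)))%:E))%E.
  have mJ A : measurable_fun A (fun y => (D%:E * (lambda * (1 - q k) * expR (- (lambda * (1 - q k) * y)))%:E)%E).
    apply/measurable_funTS/measurable_funeM/measurable_EFinP; apply: measurable_funM => //.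
    apply: measurableT_comp => //; apply: measurable_funN; exact: measurable_funM.
  rewrite -[RHS]integral_itv_obnd_cbnd// -[RHS]integral_itv_bndo_bndc//.
  apply: eq_integral => y; rewrite inE/= in_itv/= => /andP[by' yk].
  rewrite -EFinM; congr EFin.
  rewrite /h (survival_cell lambda q kT); last by lra.
  have kT' : k.+1%:R <= T%:R :> R by rewrite ler_nat.
  rewrite /kill_prob ifT; last by lra.
  rewrite (@truncn_def _ _ k); last by lra.
  have E : expR (- (lambda * q k * (k.+1%:R - (t + y)))) * expR (- (lambda * y)) =
    expR (- (lambda * q k * (k.+1%:R - t))) * expR (- (lambda * (1 - q k) * y)).
    by rewrite -!expRD; congr expR; ring.
  rewrite /D; transitivity ((1 - q k) * lambda * surv k.+1%:R *
    (expR (- (lambda * q k * (k.+1%:R - (t + y)))) * expR (- (lambda * y)))); first by ring.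
  by rewrite E; ring.
rewrite ge0_integralZl//.
- rewrite integral_expR_itv; last by lra.
  rewrite -EFinM; congr EFin; rewrite /D.
  move: (surv k.+1%:R) => C.
  transitivity (C * (expR (- (lambda * q k * (k.+1%:R - t))) * expR (- (lambda * (1 - q k) * (b - t))))
    - C * (expR (- (lambda * q k * (k.+1%:R - t))) * expR (- (lambda * (1 - q k) * (k.+1%:R - t))))).
    by ring.
  rewrite -!expRD [RHS](_ : _ = C * (expR (- (lambda * (b - t)) + - (lambda * q k * (k.+1%:R - b)))) - C * expR (- (lambda * (k.+1%:R - t)))); last by rewrite expRD; ring.
  by congr (C * expR _ - C * expR _); ring.
- apply/measurable_funTS/measurable_EFinP; apply: measurable_funM => //.
  apply: measurableT_comp => //; apply: measurable_funN; exact: measurable_funM.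
- move=> y _; rewrite lee_fin !mulr_ge0 ?expR_ge0 ?subr_ge0//; exact: ltW.
- by rewrite lee_fin mulr_ge0 ?expR_ge0// ltW// survival_gt0.
- exact: mI.
Qed.

(** The renewal equation, by conditioning on the next move after t, at time t + y: that move must be
    survived, and then the interval [t + y, T]. It is [integral_survivaly] at b = t. *)
Lemma integral_survival (nu : {finite_measure set (measurableTypeR R) -> \bar R}) (t : R) :
  (forall B, measurable B -> nu B = exponential_prob lambda B) -> 0 <= t ->
  (\int[nu]_y ((1 - kill (t + y)) * surv (t + y))%:E = (surv t)%:E)%E.
Proof.
move=> nuE t0.
rewrite (ge0_integral_density (p := EFin \o exponential_pdf lambda) (mu := lebesgue_measure))//=.
- have := integral_survivaly t t0; rewrite subrr mulr0 oppr0 expR0 mul1r => <-.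
  rewrite [RHS]integral_mkcond; apply: eq_integral => y _.
  rewrite patchE /exponential_pdf patchE; case: ifPn => _; last by rewrite mule0.
  by rewrite -EFinM mulNr.

- by apply/measurable_EFinP; exact: measurable_exponential_pdf.
- apply/measurable_EFinP; apply: (measurableT_comp (f := h)); last exact: measurable_funD.
  apply: measurable_funM; last exact: measurable_survival.
  by apply: measurable_funB => //; exact: measurable_kill_prob.
- move=> y; rewrite lee_fin mulr_ge0 ?subr_ge0 ?kill_prob_le1//.
  exact/ltW/survival_gt0.
Qed.

End exponential_survival.

(** The joint law agrees with the product of the marginals on rectangles, hence everywhere, and
    Tonelli's theorem applies. *)
Lemma ge0_integral_independent d d1 d2 (Omega : measurableType d)
    (T1 : measurableType d1) (T2 : measurableType d2) (R : realType)
    (P : probability Omega R) (X : {RV P >-> T1}) (Z : {RV P >-> T2})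
    (f : T1 * T2 -> \bar R) :
  (forall A B, measurable A -> measurable B ->
    P (X @^-1` A `&` Z @^-1` B) = P (X @^-1` A) * P (Z @^-1` B))%E ->
  measurable_fun setT f -> (forall x, 0 <= f x)%E ->
  (\int[P]_w f (X w, Z w) = \int[P]_w \int[distribution P Z]_z f (X w, z))%E.
Proof.
move=> XZ mf f0.
have mW : measurable_fun [set: Omega] (fun w => (X w, Z w)).
  exact: measurable_fun_pair.
pose W : {mfun Omega >-> (T1 * T2)%type} := mfun_Sub (mem_set mW).
rewrite -[LHS](@ge0_integral_distribution _ _ _ _ _ P W)//.
pose PX : probability T1 R := distribution P X.
pose PZ : probability T2 R := distribution P Z.
have mF : measurable_fun setT (fubini_F PZ f) by exact: measurable_fun_fubini_tonelli_F.
transitivity (\int[(PX \x PZ)%E]_x f x)%E.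
  apply: eq_measure_integral => A mA _.
  by apply/esym/product_measure_unique.
rewrite (fubini_tonelli1 (m1 := PX) (m2 := PZ))//.
rewrite ge0_integral_distribution// => x; exact: integral_ge0.
Qed.

(** * Independence of the holding times *)

Section independent_prefix.
Context d (Omega : measurableType d) (R : realType) (P : probability Omega R).
Variable xi : nat -> {RV P >-> R}.
Hypothesis indep : mutually_independent xi.

(** A pi-system generating the sigma-algebra of the first n holding times. *)
Definition cylinders (n : nat) : set (set Omega) :=
  [set A | exists2 B : nat -> set R, (forall i, measurable (B i)) &
     A = \bigcap_(i in `I_n) (xi i @^-1` B i)].

(** Mutual independence is applied to the indices up to n and to those below n, with the same family
    [D]; the two products differ by the factor at n. *)
Lemma independent_cylinder n (A : set Omega) (B : set R) :
  cylinders n A -> measurable B ->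
  (P (A `&` xi n @^-1` B) = P A * P (xi n @^-1` B))%E.
Proof.
move=> [C mC ->] mB.
pose F := [fset i in iota 0 n]%fset.
pose D i := if (i < n)%N then C i else B.
have mD i : measurable (D i) by rewrite /D; case: ifPn.
have FE : [set` F] = `I_n.
  apply/seteqP; split=> i /=; rewrite !inE mem_iota add0n => //.
have nF : n \notin F by rewrite !inE mem_iota; lia.
have F'E : [set` (n |` F)%fset] = n |` `I_n.
  by rewrite -FE; apply/seteqP; split=> i; rewrite /= in_fset1U;
    [move=> /orP[/eqP->|]; [left|right]|move=> [->|->]; rewrite ?eqxx ?orbT].
have := indep (n |` F)%fset mD; rewrite big_fsetU1//= -(indep F mD) FE F'E.
have Dn : D n = B by rewrite /D ltnn.
rewrite bigcap_setU1 Dn setIC muleC.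
have -> : \bigcap_(i in `I_n) xi i @^-1` D i = \bigcap_(i in `I_n) xi i @^-1` C i.
  by apply: eq_bigcapr => i /= iN; rewrite /D iN.
by [].
Qed.

Lemma cylindersI n : setI_closed (cylinders n).
Proof.
move=> _ _ [B mB ->] [C mC ->]; exists (fun i => B i `&` C i).
  by move=> i; exact: measurableI.
by rewrite -bigcapI.
Qed.

Lemma measurable_cylinder n A : cylinders n A -> measurable A.
Proof.
move=> [B mB ->]; apply: bigcap_measurableType => i _.
by rewrite -[_ @^-1` _]setTI; exact: measurable_funP.
Qed.

(** Dynkin's pi-lambda argument: the events independent of a fixed event form a lambda-system, and
    this one contains the cylinders. *)
Lemma independent_prefix n (A : set Omega) (B : set R) :
  <<s cylinders n >> A -> measurable B ->
  (P (A `&` xi n @^-1` B) = P A * P (xi n @^-1` B))%E.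
Proof.
move=> sA mB; set C := xi n @^-1` B.
have mC : measurable C by rewrite -[C]setTI; exact: measurable_funP.
suff : [set A | measurable A /\ P (A `&` C) = (P A * P C)%E] A by case.
apply: (lambda_system_subset (@cylindersI n) _ _ _ sA) => //; last first.
  by move=> D cD; split; [exact: measurable_cylinder cD|exact: independent_cylinder].
apply/dynkin_lambda_system; split => /=.
- by split=> //; rewrite setTI probability_setT mul1e.
- move=> D [mD DC]; split; first exact: measurableC.
  rewrite setIC -setDE measureD//; last by rewrite ltey_eq fin_num_measure.
  rewrite setIC [X in (_ - X)%E]DC probability_setC// muleBl ?mul1e//.
  + exact: fin_num_measure.
- move=> F tF HF.
  split; first by apply: bigcup_measurable => k _; have [] := HF k.
  rewrite setI_bigcupl.
  have tFC : trivIset setT (fun k => F k `&` C).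
    exact: trivIset_setIr.
  rewrite !measure_semi_bigcup//; last 4 first.
  - by move=> k; have [] := HF k.
  - by apply: bigcup_measurable => k _; have [] := HF k.
  - by move=> k; apply: measurableI => //; have [] := HF k.
  - by apply: bigcup_measurable => k _; apply: measurableI => //; have [] := HF k.
  rewrite muleC -(fineK (fin_num_measure P _ mC)) -nneseriesZl//.
  apply: eq_eseriesr => k _; rewrite fineK ?fin_num_measure// muleC.
  by have [] := HF k.
Qed.

End independent_prefix.

(** The measurable space is abstract because the lemma serves both for [Omega] and for [Omega] with
    the coarser sigma-algebra of the first n holding times. *)
Lemma measurable_move_prod d (S : measurableType d) (R : realType)
    (q : nat -> R) (T n : nat) (x : nat -> S -> R) :
  (forall i, (i < n)%N -> measurable_fun [set: S] (x i)) ->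
  measurable_fun [set: S]
    (fun w => \prod_(i < n) (1 - kill_prob q T (\sum_(j < i.+1) x j w))).
Proof.
move=> mx; apply: measurable_prod => i _; apply: measurable_funB => //.
apply: measurableT_comp; first exact: measurable_kill_prob.
by apply: measurable_sum => j; apply: mx; apply: leq_ltn_trans (ltn_ord i); rewrite -ltnS.
Qed.

Section exponential_holding_times.
Context d (Omega : measurableType d) (R : realType) (P : probability Omega R).
Variables (xi : nat -> {RV P >-> R}) (lambda : R).
Hypothesis lambda0 : 0 < lambda.
Hypothesis indep : mutually_independent xi.
Hypothesis xi_exp : forall i (B : set R), measurable B ->
  distribution P (xi i) B = exponential_prob lambda B.

Local Notation tau := (move_time xi).

Lemma holding_ge0 : {ae P, forall w, forall i, 0 <= xi i w}.
Proof.
apply/ae_foralln => i.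
have mN : measurable (`]-oo, 0%R[%classic : set R) by exact: measurable_itv.
have : P.-negligible (xi i @^-1` `]-oo, 0%R[%classic).
  apply/negligibleP; first by rewrite -[_ @^-1` _]setTI; exact: measurable_funP.
  have := xi_exp i mN; rewrite /distribution/= /pushforward => ->.
  rewrite /exponential_prob integral0_eq// => x; rewrite /= in_itv/= => x0.
  by rewrite lt0_exponential_pdf.
by apply: negligibleS => w /= /negP; rewrite -ltNge in_itv/=.
Qed.

Lemma measurable_move_time n : measurable_fun [set: Omega] (tau n).
Proof. by apply: measurable_sum => i. Qed.

Lemma prefix_measurable_holding n i : (i < n)%N ->
  measurable_fun [set: g_sigma_algebraType (cylinders xi n)] (xi i : Omega -> R).
Proof.
move=> ni _ B mB; rewrite setTI; apply: sub_sigma_algebra.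
exists (fun j => if j == i then B else setT); first by move=> j; case: ifP.
apply/seteqP; split=> w /=.
  by move=> Bw j _ /=; case: ifPn => // /eqP ->.
by move=> /(_ i ni)/=; rewrite eqxx.
Qed.

Section kill.
Variables (q : nat -> R) (T : nat).

(** When q takes values in [0, 1], this is the probability of surviving the first n moves, given the
    move times. *)
Definition move_prod n w : R := \prod_(i < n) (1 - kill_prob q T (tau i.+1 w)).

Lemma measurable_move_prod_tau n : measurable_fun [set: Omega] (move_prod n).
Proof. by apply: (@measurable_move_prod _ _ _ q T n xi) => i _. Qed.

Hypothesis q1 : forall k, q k <= 1.

Lemma move_prod_ge0 n w : 0 <= move_prod n w.
Proof. by apply: prodr_ge0 => i _; rewrite subr_ge0 kill_prob_le1. Qed.

Local Notation surv := (survival lambda q T).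

Lemma measurable_move_prod_survival n :
  measurable_fun [set: Omega] (fun w => (move_prod n w * surv (tau n w))%:E).
Proof.
apply/measurable_EFinP; apply: measurable_funM; first exact: measurable_move_prod_tau.
by apply: measurableT_comp; [exact: measurable_survival|exact: measurable_move_time].
Qed.

(* [move_prod n w * surv (tau n w)] is a martingale: by [integral_survival], integrating out
   the next holding time leaves its value unchanged. *)
Lemma expectation_move_prod_survival n :
  (\int[P]_w (move_prod n w * surv (tau n w))%:E = (surv 0)%:E)%E.
Proof.
elim: n => [|n IH].
  under eq_integral => w _ do rewrite /move_prod /move_time !big_ord0 mul1r.
  by rewrite integral_cst//= probability_setT mule1.
have mY : measurable_fun [set: Omega] (fun w => (move_prod n w, tau n w)).
  by apply: measurable_fun_pair; [exact: measurable_move_prod_tau|exact: measurable_move_time].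
pose Y : {mfun Omega >-> (R * R)%type} := mfun_Sub (mem_set mY).
(* [R] and [measurableTypeR R] carry the same sigma-algebra under different displays. *)
have mZ : @measurable_fun _ _ Omega (measurableTypeR R) setT (xi n) := measurable_funPT (xi n).
pose Z : {mfun Omega >-> measurableTypeR R} := @mfun_Sub _ _ Omega (measurableTypeR R) (xi n) (mem_set mZ).
pose h (s : R) := (1 - kill_prob q T s) * surv s.
have mh : measurable_fun [set: R] h.
  apply: measurable_funM; last exact: measurable_survival.
  by apply: measurable_funB => //; exact: measurable_kill_prob.
have h0 s : 0 <= h s by rewrite mulr_ge0 ?subr_ge0 ?kill_prob_le1// ltW// survival_gt0.
(* The absolute value makes [f] nonnegative on the whole product space; it changes nothing on the
   values of [Y], as [move_prod] is nonnegative. *)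
pose f (z : (R * R) * measurableTypeR R) : \bar R := (`|z.1.1| * h (z.1.2 + z.2))%:E.
have mf : measurable_fun setT f.
  apply/measurable_EFinP; apply: measurable_funM.
    by apply: measurableT_comp => //; apply: measurableT_comp.
  apply: measurableT_comp => //; apply: measurable_funD => //.
  by apply: measurableT_comp.
transitivity (\int[P]_w f (Y w, Z w))%E.
  apply: eq_integral => w _; rewrite /f/= ger0_norm ?move_prod_ge0//.
  rewrite /h /move_prod big_ord_recr/= mulrA.
  by rewrite -[tau n w + _](_ : tau n.+1 w = _)// /move_time big_ord_recr.
rewrite ge0_integral_independent//; last 2 first.
- move=> A B mA mB; apply: (independent_prefix indep (n := n)) => //.
  (* The pair depends on the holding times before index n only, hence is independent of [xi n]. *)
  have : measurable_fun [set: g_sigma_algebraType (cylinders xi n)]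
      (fun w : Omega => (move_prod n w, tau n w)).
    apply: measurable_fun_pair.
      apply: (@measurable_move_prod _ (g_sigma_algebraType (cylinders xi n)) _ q T n (fun i => xi i : Omega -> R)) => i; exact: prefix_measurable_holding.
    by apply: measurable_sum => i; exact: prefix_measurable_holding.
  by move=> /(_ measurableT _ mA); rewrite setTI.
- by move=> z; rewrite lee_fin mulr_ge0.
pose PZ : probability (measurableTypeR R) R := distribution P Z.
have inner w : (forall i, 0 <= xi i w) ->
    (\int[PZ]_z f (Y w, z) = (move_prod n w * surv (tau n w))%:E)%E.
  move=> xi0.
  rewrite /f/= ger0_norm ?move_prod_ge0//.
  under eq_integral => z _ do rewrite EFinM.
  rewrite ge0_integralZl//; last 3 first.
  - by apply/measurable_EFinP; apply: measurableT_comp => //; exact: measurable_funD.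
  - by move=> z _; rewrite lee_fin.
  - by rewrite lee_fin move_prod_ge0.
  rewrite (integral_survival T lambda0 q1)//; last by exact: sumr_ge0.
  exact: xi_exp.
rewrite -IH; apply: ge0_ae_eq_integral => //.
- have mF : measurable_fun setT (fubini_F PZ f).
    by apply: measurable_fun_fubini_tonelli_F => // z; rewrite lee_fin mulr_ge0.
  exact: (measurableT_comp mF).
- exact: measurable_move_prod_survival.
- by move=> w _; apply: integral_ge0 => z _; rewrite lee_fin mulr_ge0.
- by move=> w _; rewrite lee_fin mulr_ge0 ?move_prod_ge0// ltW// survival_gt0.
- by move: holding_ge0; apply: filterS => w xi0 _; exact: inner.
Qed.

End kill.

Lemma le_move_time w m n : (forall i, 0 <= xi i w) -> (m <= n)%N ->
  tau m w <= tau n w.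
Proof.
move=> xi0 mn; rewrite /move_time -(subnKC mn) big_split_ord/= lerDl.
exact: sumr_ge0.
Qed.

Lemma measurable_move_time_le (T n : nat) :
  measurable [set w | tau n w <= T%:R].
Proof.
have := measurable_move_time n measurableT (measurable_itv `]-oo, (T%:R : R)]).
by rewrite setTI; congr measurable; apply/seteqP; split=> w; rewrite /= in_itv.
Qed.

(** Non-explosion, which allows passing from the first n moves to all the moves up to T. *)
Lemma le_move_time_cvg0 (T : nat) :
  (fun n => P [set w | tau n w <= T%:R]) @ \oo --> 0%E.
Proof.
(* With q = -1 the martingale is at least 2^n as long as [tau n <= T]. *)
pose q (k : nat) : R := -1.
have q1 k : q k <= 1 by rewrite /q; lra.
have mA n := measurable_move_time_le T n.
have surv1 s : 1 <= survival lambda q T s.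
  rewrite /survival -[leLHS]expR0 ler_expR oppr_ge0 pmulr_rle0// sumr_le0// => k _.
  by rewrite /q mulN1r oppr_le0 le_min ler01 le_max lexx.
(* Markov's inequality for the martingale, whose mean is its initial value
   [survival lambda q T 0]. *)
have bound n : (P [set w | (tau n w <= T%:R)%R] <=
    (geometric (survival lambda q T 0) 2^-1 n)%:E)%E.
  rewrite /geometric/= exprVn mulrC EFinM lee_pdivlMl ?exprn_gt0//.
  rewrite -(expectation_move_prod_survival T q1 n).
  rewrite -[X in P X]setIT -(integral_indic P measurableT (mA n)) -ge0_integralZl//; last first.
    exact/measurable_EFinP/measurable_indic.
  apply: ae_ge0_le_integral => //.
  - by apply: measurable_funeM; exact/measurable_EFinP/measurable_indic.
  - by move=> w _; rewrite lee_fin mulr_ge0 ?move_prod_ge0// ltW// survival_gt0.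
  - exact: measurable_move_prod_survival.
  - move: holding_ge0; apply: filterS => w xi0 _.
    rewrite -EFinM lee_fin indicE; case: (boolP (_ \in _)) => [|_]; last first.
      by rewrite mulr0 mulr_ge0 ?move_prod_ge0// ltW// survival_gt0.
    rewrite inE/= => tT; rewrite mulr1.
    rewrite (_ : move_prod q T n w = 2 ^+ n).
      by rewrite ler_peMr ?exprn_ge0.
    rewrite /move_prod -[n in RHS]card_ord -prodr_const; apply: eq_bigr => i _.
    rewrite /kill_prob ifT /q ?opprK//.
    by apply: le_trans tT; exact: le_move_time.
apply: (@squeeze_cvge _ _ _ _ (cst 0%E) _ (fun n => (geometric (survival lambda q T 0) 2^-1 n)%:E)).
- by near=> n; rewrite measure_ge0 bound.
- exact: cvg_cst.
- by apply: cvg_EFin; [exact: nearW|apply: cvg_geometric; rewrite ger0_norm; lra].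
Unshelve. all: end_near. Qed.

(** When tau n > T the factor [survival] is 1, so [move_prod] coincides with the martingale.
    Otherwise the two differ by at most 1, on an event whose probability tends to 0. *)
Lemma expectation_move_prod_cvg (q : nat -> R) (T : nat) :
  (forall k, 0 <= q k <= 1) ->
  (fun n => \int[P]_w (move_prod q T n w)%:E)%E @ \oo -->
  (survival lambda q T 0)%:E.
Proof.
move=> q01.
have q1 k : q k <= 1 by have /andP[] := q01 k.
have mp0 n w := move_prod_ge0 T q1 n w.
have surv0 s := ltW (survival_gt0 lambda q T s).
have mp1 n w : move_prod q T n w <= 1.
  apply: prodr_ile1 => i _; rewrite subr_ge0 kill_prob_le1//= lerBlDr lerDl.
  by rewrite /kill_prob; case: ifPn => // _; have /andP[] := q01 (Num.truncn (tau i.+1 w)).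
have surv1 s : survival lambda q T s <= 1.
  rewrite /survival -[leRHS]expR0 ler_expR oppr_le0 pmulr_rge0// sumr_ge0// => k _.
  have /andP[q0 _] := q01 k.
  by rewrite mulr_ge0// le_min ler01 le_max lexx.
have mmp n : measurable_fun [set: Omega] (fun w => (move_prod q T n w)%:E).
  exact/measurable_EFinP/measurable_move_prod_tau.
have mI n : measurable_fun [set: Omega] (fun w => (\1_[set w | tau n w <= T%:R] w)%:E : \bar R).
  exact/measurable_EFinP/measurable_indic/measurable_move_time_le.
apply: (@squeeze_cvge _ _ _ _ (cst (survival lambda q T 0)%:E) _
  (fun n => (survival lambda q T 0)%:E + P [set w | (tau n w <= T%:R)%R])%E).
- apply: nearW => n /=; rewrite -(expectation_move_prod_survival T q1 n); apply/andP; split.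
    apply: ge0_le_integral => //.
    + by move=> w _; rewrite lee_fin mulr_ge0.
    + exact: measurable_move_prod_survival.
    + by move=> w _; rewrite lee_fin ler_piMr.
  rewrite -[X in P X]setIT -(integral_indic P measurableT (measurable_move_time_le T n)).
  rewrite -ge0_integralD//.
  + apply: ge0_le_integral => //.
    * by move=> w _; rewrite lee_fin.
    * by apply: emeasurable_funD => //; exact: measurable_move_prod_survival.
    * move=> w _; rewrite -EFinD lee_fin indicE.
      have [tT|Tt] := leP (tau n w) T%:R.
        rewrite mem_set// (le_trans (mp1 n w))// lerDr mulr_ge0//.
      rewrite memNset//= ?addr0; last by apply/negP; rewrite -ltNge.
      by rewrite survival_eq1 ?mulr1// ltW.
  + by move=> w _; rewrite lee_fin mulr_ge0.
  + exact: measurable_move_prod_survival.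
- exact: cvg_cst.
- rewrite -[X in _ --> X]adde0; apply: cvgeD => //; [exact: cvg_cst|exact: le_move_time_cvg0].
Qed.

End exponential_holding_times.

(** * The walk avoiding a set of vertices *)

Section walk_sigma_algebras.
Context d (Omega : measurableType d) (R : realType) (P : probability Omega R).
Variables (xi : nat -> {RV P >-> R}) (X : nat -> {RV P >-> nat}).

Definition holding_generators : set (set Omega) :=
  \bigcup_i preimage_set_system setT (xi i) measurable.

Definition past_generators (n : nat) : set (set Omega) :=
  holding_generators `|` \bigcup_(m in [set m | (m <= n)%N])
    preimage_set_system setT (X m) measurable.

(** The past of move n contains all the holding times, later ones included, so the next jump may be
    conditioned on its own time. *)
Lemma holding_past n B : <<s holding_generators >> B -> past xi X n B.
Proof.
apply: smallest_sub; first exact: smallest_sigma_algebra.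
by move=> A hA; apply: sub_sigma_algebra; left.
Qed.

Lemma past_measurable n B : past xi X n B -> measurable B.
Proof.
apply: smallest_sub; first exact: sigma_algebra_measurable.
rewrite /past_generators /holding_generators => C [[i _ [A mA <-]]|[m _ [A mA <-]]].
- exact: measurable_funPT.
- exact: measurable_funPT.
Qed.

Lemma holding_measurable_holding i :
  measurable_fun [set: g_sigma_algebraType holding_generators] (xi i : Omega -> R).
Proof.
move=> _ B mB; apply: sub_sigma_algebra; exists i => //.
by exists B.
Qed.

Lemma past_measurable_walker n m : (m <= n)%N ->
  measurable_fun [set: g_sigma_algebraType (past_generators n)] (X m : Omega -> nat).
Proof.
move=> mn _ B mB; apply: sub_sigma_algebra; right; exists m => //.
by exists B.
Qed.

Lemma holding_move_time n (A : set R) : measurable A ->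
  <<s holding_generators >> (move_time xi n @^-1` A).
Proof.
move=> mA; have : measurable_fun [set: g_sigma_algebraType holding_generators]
    (move_time xi n : Omega -> R).
  by apply: measurable_sum => i; exact: holding_measurable_holding.
by move=> /(_ measurableT _ mA); rewrite setTI.
Qed.

End walk_sigma_algebras.

Lemma measurable_fun_nat2 (R : realType) (f : nat * nat -> R) :
  measurable_fun [set: nat * nat] f.
Proof.
move=> _ B _; apply: countable_measurable; last exact: countableP.
move=> [a b]; rewrite (_ : [set (a, b)] = [set a] `*` [set b]).
  exact: measurableX.
by apply/seteqP; split=> [[x y] [-> ->]|[x y] [/= -> ->]].
Qed.

Section vertices.
Variables (R : realType) (k0 : nat).
Implicit Types (s : R) (j x : nat).

Lemma mem_vertices s j : (j \in vertices k0 s) = (0 < j <= k0 + Num.truncn s)%N.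
Proof. by rewrite mem_iota; lia. Qed.

Lemma size_targets s x : x \in vertices k0 s ->
  size (targets k0 s x) = (k0 + Num.truncn s).-1.
Proof.
move=> xs; rewrite /targets -rem_filter ?iota_uniq// size_rem//.
by rewrite size_iota.
Qed.

Lemma jump_probE s x j : x \in vertices k0 s -> j != x -> (0 < j)%N ->
  jump_prob k0 s x j =
    (j <= k0 + Num.truncn s)%N%:R / (k0 + Num.truncn s).-1%:R.
Proof.
move=> xs jx j0; rewrite /jump_prob size_targets// mem_filter jx mem_vertices.
by rewrite j0.
Qed.

End vertices.

Section walk.
Context d (Omega : measurableType d) (R : realType) (P : probability Omega R).
Variables (k0 : nat) (lambda : R).
Variables (xi : nat -> {RV P >-> R}) (X : nat -> {RV P >-> nat}).
Hypotheses (k0_ge3 : (3 <= k0)%N) (lambda0 : 0 < lambda).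
Hypothesis walk : growing_complete_walk k0 xi X lambda.

Local Notation tau := (move_time xi).

Lemma measurable_jump_prob n y : measurable_fun [set: Omega]
  (fun w => jump_prob k0 (tau n.+1 w) (X n w) y).
Proof.
pose f (z : nat * nat) : R := let r := [seq v <- iota 1 (k0 + z.1) | v != z.2] in
  (y \in r)%:R / (size r)%:R.
have mg : measurable_fun [set: Omega] (fun w => (Num.truncn (tau n.+1 w), X n w)).
  apply: measurable_fun_pair; last exact: measurable_funPT.
  apply: measurableT_comp; first exact: measurable_truncn.
  exact: measurable_move_time.
exact: (measurableT_comp (measurable_fun_nat2 f) mg).
Qed.

(** That y is absent at the time of a move is an event of the holding times, and on it the jump to y
    has conditional probability 0. There are countably many y. *)
Lemma walker_in_vertices : {ae P, forall w, forall n, X n w \in vertices k0 (tau n w)}.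
Proof.
apply/ae_foralln => -[|n].
  apply: aeW => w; rewrite (walk_start walk) mem_vertices; lia.
have hB y : <<s holding_generators xi >> [set w | y \notin vertices k0 (tau n.+1 w)].
  have mA : measurable [set s : R | y \notin vertices k0 s].
    have := @measurable_truncn R measurableT [set k | y \notin iota 1 (k0 + k)].
    by rewrite setTI; apply.
  exact: (@holding_move_time _ _ _ _ xi n.+1 _ mA).
have pB y := @holding_past _ _ _ _ xi X n _ (hB y).
pose N y := [set w | y \notin vertices k0 (tau n.+1 w)] `&` [set w | X n.+1 w = y].
have : P.-negligible (\bigcup_y N y).
  apply: negligible_bigcup => y; apply/negligibleP.
    apply: measurableI; first exact: past_measurable (pB y).
    by rewrite -[X in measurable X]setTI; exact: (measurable_funPT (X n.+1) measurableT [set y]).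
  apply: (etrans (walk_jump walk y (pB y))).
  rewrite integral0_eq// => w /= yv; congr EFin.
  by rewrite /jump_prob mem_filter (negbTE yv) andbF mul0r.
by apply: negligibleS => w /= /negP Xv; exists (X n.+1 w).
Qed.

Section avoid.
Variables (S : seq nat) (T : nat).
Hypotheses (S_uniq : uniq S) (S_size : (size S <= 2)%N).
Hypothesis S_ge2 : forall j, j \in S -> (2 <= j)%N.

(* A walker outside [S] jumps into [S] with this probability at any time in [k, k+1). *)
Definition hit_prob (k : nat) : R :=
  (count (fun j => j <= k0 + k)%N S)%:R / (k0 + k).-1%:R.

Definition avoid (n : nat) : set Omega :=
  [set w | forall m, (m <= n)%N -> tau m w <= T%:R -> X m w \notin S].

(** A jump has k0 + k - 1 >= 2 possible targets, and [S] has at most two elements. *)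
Lemma hit_prob01 k : 0 <= hit_prob k <= 1.
Proof.
rewrite divr_ge0//= ler_pdivrMr ?ltr0n ?mul1r ?ler_nat; last by lia.
have := count_size (fun j => j <= k0 + k)%N S; lia.
Qed.

Lemma past_avoid n : past xi X n (avoid n).
Proof.
have -> : avoid n = \bigcap_(m in [set m | (m <= n)%N])
    (tau m @^-1` `]T%:R, +oo[ `|` X m @^-1` [set x | x \notin S]).
  apply/seteqP; split=> w /= Sw m /= mn.
    rewrite /= in_itv/= andbT; have [|_] := leP (tau m w) T%:R; last by left.
    by move=> /(Sw m mn); right.
  by have := Sw m mn => /= -[]; rewrite /= ?in_itv/= ?andbT// ltNge => /negP.
have : @measurable _ (g_sigma_algebraType (past_generators xi X n))
    (\bigcap_(m in [set m | (m <= n)%N])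
    (tau m @^-1` `]T%:R, +oo[ `|` X m @^-1` [set x | x \notin S])).
  apply: bigcap_measurableType => m /= mn; apply: measurableU.
    by apply: (@holding_past _ _ _ _ xi X n); exact: holding_move_time.
  have := @past_measurable_walker _ _ _ _ xi X n m mn measurableT [set x | x \notin S].
  by rewrite setTI; apply.
by [].
Qed.

Lemma prob_mem_seq (D : set Omega) (n : nat) : measurable D ->
  (P (D `&` [set w | X n w \in S]) = \sum_(j <- S) P (D `&` [set w | X n w = j]))%E.
Proof.
move=> mD; elim: S S_uniq => [_|a s IH /= /andP[ans us]].
  rewrite big_nil (_ : _ `&` _ = set0) ?measure0//.
  by apply/seteqP; split=> w //= [].
rewrite big_cons -IH// -measureU.
- congr (P _); rewrite -setIUr; congr (_ `&` _); apply/seteqP; split=> w /=; rewrite inE.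
    by move=> /orP[/eqP|]; [left|right].
  by move=> [->|->]; rewrite ?eqxx ?orbT.
- apply: measurableI => //.
  by rewrite -[X in measurable X]setTI; exact: (measurable_funPT (X n) measurableT [set a]).
- apply: measurableI => //.
  by rewrite -[X in measurable X]setTI; exact: (measurable_funPT (X n) measurableT [set x | x \in s]).
- by apply/seteqP; split=> w //= [[_ ->] [_]]; rewrite (negbTE ans).
Qed.

(** On [D] the walker is outside [S] just before the jump, since tau n <= tau n.+1 <= T. Each j in
    [S] is then hit with a conditional probability that is constant on [D], and these constants add
    up to [hit_prob k]. *)
Lemma prob_hit n k (D : set Omega) : past xi X n D -> D `<=` avoid n ->
  D `<=` [set w | tau n.+1 w <= T%:R /\ Num.truncn (tau n.+1 w) = k] ->
  (P (D `&` [set w | X n.+1 w \in S]) = (hit_prob k)%:E * P D)%E.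
Proof.
move=> pD Dav Dk; have mD := past_measurable pD.
rewrite prob_mem_seq//.
pose c j : R := (j <= k0 + k)%N%:R / (k0 + k).-1%:R.
have jump j : j \in S -> (P (D `&` [set w | X n.+1 w = j]) = (c j)%:E * P D)%E.
  move=> jS; apply: etrans (walk_jump walk j pD) _.
  rewrite -integral_cst//; apply: ae_eq_integral => //.
    exact/measurable_EFinP/measurable_funTS/measurable_jump_prob.
  apply: filterS2 walker_in_vertices (holding_ge0 (holding_exponential walk)) => w Xv xi0 Dw.
  have [tT tk] := Dk _ Dw.
  have tt : tau n w <= tau n.+1 w by exact: le_move_time.
  congr EFin; rewrite jump_probE ?tk//.
  - move: (Xv n); rewrite !mem_vertices => /andP[->] /leq_trans; apply.
    by rewrite leq_add2l le_truncn.
  - by apply: contraTneq jS => ->; apply: (Dav _ Dw n) => //; exact: le_trans tT.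
  - exact: leq_trans (S_ge2 jS).
rewrite (eq_big_seq _ jump) -ge0_sume_distrl; last by move=> j _; rewrite lee_fin divr_ge0.
rewrite sumEFin; congr (_%:E * _)%E; rewrite /c -mulr_suml; congr (_ / _).
by rewrite -sum1_count [in RHS]big_mkcond natr_sum; apply: eq_bigr => j _; case: ifP.
Qed.

(* Quantifying over all [B] determined by the holding times amounts to conditioning on them. *)
Lemma prob_avoid n (B : set Omega) : <<s holding_generators xi >> B ->
  (P (avoid n `&` B) = \int[P]_(w in B) (move_prod xi hit_prob T n w)%:E)%E.
Proof.
have hm C : <<s holding_generators xi >> C -> measurable C.
  by move=> /(@holding_past _ _ _ _ xi X 0)/past_measurable.
elim: n B => [|n IH] B hB.
  under eq_integral do rewrite /move_prod big_ord0.
  rewrite integral_cst//= ?mul1e; last exact: hm.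
  congr (P _); apply/setIidr => w _ m; rewrite leqn0 => /eqP -> _.
  by rewrite (walk_start walk); apply/negP => /S_ge2.
(* [B] is cut along the integer part of the next move time, so that the killing probability is
   constant on each cell. The value T.+1 stands for all times after T. *)
pose level (s : R) := if s <= T%:R then Num.truncn s else T.+1.
pose cell k := B `&` [set w | level (tau n.+1 w) = k].
have mlevel : measurable_fun [set: R] level.
  apply: measurable_fun_ifT => //; first exact: measurable_fun_ler.
  exact: measurable_truncn.
have hcell k : <<s holding_generators xi >> (cell k).
  have mk : measurable [set s | level s = k].
    by have := mlevel measurableT [set k]; rewrite setTI; apply.
  have := @measurableI _ (g_sigma_algebraType (holding_generators xi)) B _ hB
    (@holding_move_time _ _ _ _ xi n.+1 _ mk).
  by [].
have mcell k : measurable (cell k) by exact: hm.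
have tcell : trivIset setT cell.
  by move=> i j _ _ [w [[_ /= <-] [_ /= <-]]].
have Bcell : B = \bigcup_k cell k.
  by apply/seteqP; split=> [w Bw|w [k _ []//]]; exists (level (tau n.+1 w)).
have mav m : measurable (avoid m) := past_measurable (past_avoid (n := m)).
rewrite {1}Bcell setI_bigcupr measure_semi_bigcup; last 3 first.
- by move=> k; exact: measurableI.
- exact: trivIset_setIl.
- by apply: bigcup_measurable => k _; exact: measurableI.
rewrite [in RHS]Bcell ge0_integral_bigcup//; last 2 first.
- exact/measurable_EFinP/measurable_funTS/measurable_move_prod_tau.
- move=> w _; rewrite lee_fin move_prod_ge0// => k.
  by have /andP[] := hit_prob01 k.
apply: eq_eseriesr => k _.
(* The case k = T is that of a move exactly at time T, which still counts. *)
pose r := if (k <= T)%N then hit_prob k else 0.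
have killE w : cell k w -> kill_prob hit_prob T (tau n.+1 w) = r.
  move=> [_ /=]; rewrite /level /kill_prob /r; case: ifPn => [tT <-|_ <-]; last by rewrite ltnn.
  by rewrite ifT// -[leqRHS](@natrK R T) le_truncn.
transitivity ((1 - r)%:E * P (avoid n `&` cell k))%E.
  rewrite /r; case: ifPn => kT; last first.
    (* The next move falls after T, so it imposes no further constraint. *)
    rewrite subr0 mul1e; congr (P _); apply/seteqP; split=> w [av Cw]; split=> // m mn tm.
      by apply: av => //; exact: leqW.
    move: mn; rewrite leq_eqVlt => /predU1P[mE|]; last by move=> ?; exact: av.
    move: Cw => [_ /=]; rewrite /level -mE ifT// => kE; move: kT.
    by rewrite -kE -[X in (_ <= X)%N](@natrK R T) le_truncn.
  pose D := avoid n `&` cell k.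
  have pD : past xi X n D.
    have := @measurableI _ (g_sigma_algebraType (past_generators xi X n)) _ _
      (past_avoid (n := n)) (@holding_past _ _ _ _ xi X n _ (hcell k)).
    by [].
  have Dk : D `<=` [set w | tau n.+1 w <= T%:R /\ Num.truncn (tau n.+1 w) = k].
    move=> w [_ [_ /=]]; rewrite /level; case: ifPn => // _ kE.
    by move: kT; rewrite -kE ltnn.
  (* The next move falls before or at T, so avoiding [S] once more means removing the jumps into
     [S]. *)
  rewrite (_ : avoid n.+1 `&` _ = D `\` [set w | X n.+1 w \in S]); last first.
    apply/seteqP; split=> w.
      move=> [av Cw]; have Dw : D w by split=> // m mn; apply: av; exact: leqW.
      by split=> //=; apply/negP; apply: av => //; have [] := Dk _ Dw.
    move=> [[av Cw] /= /negP XS]; split=> // m; rewrite leq_eqVlt => /predU1P[->//|].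
    exact: av.
  have mD := past_measurable pD.
  rewrite measureD//; last 2 first.
  - rewrite -[X in measurable X]setTI.
    exact: (measurable_funPT (X n.+1) measurableT [set x | x \in S]).
  - by rewrite ltey_eq fin_num_measure.
  have hit := prob_hit pD (fun w => @proj1 _ _) Dk.
  rewrite [X in (_ - X)%E](etrans _ hit)//.
  have [p pE] : exists p, P D = p%:E.
    by exists (fine (P D)); rewrite fineK// fin_num_measure.
  transitivity (p%:E - (hit_prob k)%:E * p%:E)%E; first by rewrite -pE.
  transitivity ((1 - hit_prob k)%:E * p%:E)%E; last by rewrite -pE.
  by rewrite -!EFinM -EFinB; congr EFin; ring.
rewrite IH//.
have mp_ge0 w : 0 <= move_prod xi hit_prob T n w.
  by apply: move_prod_ge0 => j; have /andP[] := hit_prob01 j.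
rewrite -ge0_integralZl//.
- apply: eq_integral => w; rewrite inE => Cw.
  by rewrite /move_prod big_ord_recr/= killE// mulrC EFinM.
- exact/measurable_EFinP/measurable_funTS/measurable_move_prod_tau.
- by move=> w _; rewrite lee_fin.
- by rewrite lee_fin subr_ge0 /r; case: ifPn => // _; have /andP[] := hit_prob01 k.
Qed.

(** The events [avoid n] decrease to the event on the left. Their probabilities are the means of
    [move_prod], which tend to [survival] at 0. *)
Lemma prob_unvisited :
  P [set w | forall j, j \in S -> unvisited xi X T j w]
  = (expR (- (lambda * \sum_(k < T) hit_prob k)))%:E.
Proof.
have mav m : measurable (avoid m) := past_measurable (past_avoid (n := m)).
have -> : [set w | forall j, j \in S -> unvisited xi X T j w] = \bigcap_n avoid n.
  apply/seteqP; split=> w /=.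
    by move=> Sw n _ m _ tm; apply/negP => /Sw; apply; exists m.
  move=> Sw j jS [n [tn Xn]]; have := Sw n I n (leqnn n) tn.
  by rewrite Xn jS.
rewrite -(survival0 lambda hit_prob T).
have avcvg : (P \o avoid) n @[n --> \oo] --> P (\bigcap_n avoid n).
  apply: nonincreasing_cvg_mu => //.
  - by rewrite ltey_eq fin_num_measure.
  - exact: bigcap_measurableType.
  - by move=> m n mn; apply/subsetPset => w av l lm; apply: av; exact: leq_trans mn.
apply: (@cvg_unique _ _ _ _ _ _ avcvg) => //.
rewrite (_ : P \o avoid = fun n => \int[P]_w (move_prod xi hit_prob T n w)%:E)%E.
  apply: expectation_move_prod_cvg => //.
  - exact: holding_independent walk.
  - exact: holding_exponential walk.
  - exact: hit_prob01.
apply/funext => n /=; rewrite -prob_avoid ?setIT//.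
exact: (@measurableT _ (g_sigma_algebraType (holding_generators xi))).
Qed.

End avoid.

End walk.

(** * Variance of the number of visited vertices *)

Section variance_indicators.
Context d (Omega : measurableType d) (R : realType) (P : probability Omega R).

Lemma Lfun2_indic (A : set Omega) : measurable A ->
  (\1_A : Omega -> R) \in Lfun P 2%:E.
Proof.
move=> mA; rewrite inE/=; apply/andP; split; rewrite inE/=.
  exact: measurable_indic.
rewrite /finite_norm unlock poweR_lty//.
rewrite (eq_integral (fun w => (\1_A w)%:E)); last first.
  move=> w _ /=; rewrite indicE.
  by case: (w \in A); rewrite ?normr1 ?normr0 ?powR1 ?powR0//=.
by rewrite integral_indic// setIT ltey_eq fin_num_measure.
Qed.

Lemma Lfun1_indic (A : set Omega) : measurable A ->
  (\1_A : Omega -> R) \in Lfun P 1.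
Proof.
move=> mA; apply: Lfun_subset12; last exact: Lfun2_indic.
exact: fin_num_measure.
Qed.

Lemma covariance_indic (A B : set Omega) : measurable A -> measurable B ->
  covariance P \1_A \1_B = (P (A `&` B) - P A * P B)%E.
Proof.
move=> mA mB; rewrite covarianceE ?Lfun1_indic//; last first.
  by apply: Lfun2_mul_Lfun1; exact: Lfun2_indic.
have -> : (\1_A : Omega -> R) * \1_B = \1_(A `&` B) by rewrite indicI.
by rewrite !expectation_indic//; exact: measurableI.
Qed.

Lemma Lfun2_sum_indic (I : eqType) (A : I -> set Omega) (s : seq I) :
  (forall i, i \in s -> measurable (A i)) ->
  (\sum_(i <- s) \1_(A i) : Omega -> R) \in Lfun P 2%:E.
Proof.
move=> mA; rewrite big_seq; apply: rpred_sum; first by rewrite lee1n.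
by move=> h i /mA mAi; exact: Lfun2_indic.
Qed.

(** Covariances involve two events at a time, so pairwise independence makes them all vanish. *)
Lemma variance_sum_indic (I : eqType) (A : I -> set Omega) (s : seq I) :
  uniq s -> (forall i, i \in s -> measurable (A i)) ->
  {in s &, forall i j, i != j -> P (A i `&` A j) = P (A i) * P (A j)}%E ->
  'V_P[(\sum_(i <- s) \1_(A i) : Omega -> R)]
    = (\sum_(i <- s) (P (A i) - P (A i) * P (A i)))%E.
Proof.
elim: s => [|a s IH] /= us mA ind.
  by rewrite !big_nil; exact: variance_cst.
have ms i : i \in s -> measurable (A i) by move=> si; apply: mA; rewrite inE si orbT.
have ma : measurable (A a) by apply: mA; rewrite inE eqxx.
rewrite !big_cons.
rewrite [LHS]varianceD ?Lfun2_indic ?Lfun2_sum_indic//.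
rewrite IH//; last 2 first.
  by case/andP: us.
  by move=> i j si sj; apply: ind; rewrite inE ?si ?sj orbT.
rewrite [X in (_ + _ * X)%E](_ : _ = 0%E) ?mule0 ?adde0.
  by rewrite /variance covariance_indic// setIid.
(* The sum is generalized to any list [u] contained in [s]; the induction on [u] then keeps
   membership in [s], where independence from [A a] is known. *)
have : {subset s <= s} by [].
elim: {1 3}s => [|b u IHu] us'.
  by rewrite big_nil; exact: covariance_cst_r.
have bs : b \in s by apply: us'; rewrite inE eqxx.
have mb := ms b bs.
have L2u : (\sum_(i <- u) \1_(A i) : Omega -> R) \in Lfun P 2%:E.
  by apply: Lfun2_sum_indic => i iu; apply/ms/us'; rewrite inE iu orbT.
rewrite big_cons [LHS](covarianceDr (Lfun2_indic ma) (Lfun2_indic mb) L2u).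
rewrite IHu ?adde0; last by move=> i iu; apply: us'; rewrite inE iu orbT.
rewrite covariance_indic//.
rewrite ind ?inE ?eqxx ?bs ?orbT//; last first.
  by apply: contraTneq us => ->; rewrite bs.
by rewrite subee// fin_numM ?fin_num_measure.
Qed.

End variance_indicators.

(** * Sums of hitting probabilities and harmonic numbers *)

Section hit_sums.
Variables (R : realType) (k0 : nat).
Hypothesis k0_ge3 : (3 <= k0)%N.

Lemma harmonic_numberS n :
  harmonic_number R n.+1 = harmonic_number R n + n.+1%:R^-1.
Proof. by rewrite /harmonic_number big_nat_recr. Qed.

(** The vertex v_j contributes 1/(k0 + k - 1) from k = max(j, k0) - k0 on; the maximum treats
    initial and later vertices together. *)
Lemma sum_hit_prob1 (T j : nat) : (j <= k0 + T)%N ->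
  \sum_(k < T) hit_prob R k0 [:: j] k
  = harmonic_number R (k0 + T - 2) - harmonic_number R (maxn j k0 - 2).
Proof.
elim: T => [|T IH] jT.
  by rewrite big_ord0 addn0 (_ : maxn j k0 = k0) ?subrr//; apply/maxn_idPr; lia.
rewrite big_ord_recr/= /hit_prob/= addn0.
have -> : (k0 + T.+1 - 2 = (k0 + T - 2).+1)%N by lia.
have -> : ((k0 + T).-1 = (k0 + T - 2).+1)%N by lia.
have [jT'|jT'] := leqP j (k0 + T).
  rewrite -[X in X + _]/(\sum_(k < T) hit_prob R k0 [:: j] k) IH// harmonic_numberS mul1r; ring.
(* Here j = k0 + T + 1 is created at the end of the period: every term is 0 and the two harmonic
   numbers coincide. *)
rewrite mul0r addr0 big1; last first.
  by move=> k _; rewrite /hit_prob/= addn0 leqNgt (_ : (_ < j)%N) ?mul0r//; have := ltn_ord k; lia.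
by rewrite (_ : maxn j k0 - 2 = (k0 + T - 2).+1)%N ?subrr//; lia.
Qed.

(** After exponentiation this additivity becomes the product formula for two events. *)
Lemma sum_hit_prob2 (T r s : nat) :
  \sum_(k < T) hit_prob R k0 [:: r; s] k
  = \sum_(k < T) hit_prob R k0 [:: r] k + \sum_(k < T) hit_prob R k0 [:: s] k.
Proof.
rewrite -big_split/=; apply: eq_bigr => k _.
by rewrite /hit_prob/= !addn0 natrD mulrDl.
Qed.

Lemma visit_probE (lambda : R) (T j : nat) : (j <= k0 + T)%N ->
  visit_prob k0 lambda T j =
    1 - expR (- (lambda * \sum_(k < T) hit_prob R k0 [:: j] k)).
Proof.
move=> jT; rewrite sum_hit_prob1// /visit_prob; by case: leqP.
Qed.

End hit_sums.

Section unvisited.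
Context d (Omega : measurableType d) (R : realType) (P : probability Omega R).
Variables (k0 : nat) (lambda : R).
Variables (xi : nat -> {RV P >-> R}) (X : nat -> {RV P >-> nat}).
Hypotheses (k0_ge3 : (3 <= k0)%N) (lambda0 : 0 < lambda).
Hypothesis walk : growing_complete_walk k0 xi X lambda.
Variable T : nat.

Local Notation "'A_' j" := (unvisited xi X T j) (at level 2, format "'A_' j").

Lemma prob_unvisited1 j : (2 <= j)%N -> (j <= k0 + T)%N ->
  P (A_ j) = (1 - visit_prob k0 lambda T j)%:E.
Proof.
move=> j2 jT.
have := prob_unvisited k0_ge3 lambda0 walk T (S := [:: j]) isT isT.
rewrite visit_probE// opprB addrCA subrr addr0 => <-.
  congr (P _); apply/seteqP; split=> w /=.
    by move=> Aw i; rewrite inE => /eqP ->.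
  by apply; rewrite inE.
by move=> i; rewrite inE => /eqP ->.
Qed.

Lemma prob_unvisited2 r s : (2 <= r)%N -> (2 <= s)%N -> r != s ->
  (r <= k0 + T)%N -> (s <= k0 + T)%N ->
  (P (A_ r `&` A_ s) = P (A_ r) * P (A_ s))%E.
Proof.
move=> r2 s2 rs rT sT.
rewrite !prob_unvisited1// -EFinM !visit_probE// !opprB ![1 + _]addrC !subrK -expRD.
have := prob_unvisited k0_ge3 lambda0 walk T (S := [:: r; s]).
rewrite /= inE rs => /(_ isT isT) H.
rewrite -opprD -mulrDr -sum_hit_prob2 -H.
  congr (P _); apply/seteqP; split=> w /=.
    by move=> [Ar As] i; rewrite !inE => /orP[/eqP ->|/eqP ->].
  by move=> Aw; split; apply: Aw; rewrite !inE eqxx ?orbT.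
by move=> i; rewrite !inE => /orP[/eqP ->|/eqP ->].
Qed.

Lemma measurable_unvisited j : measurable (A_ j).
Proof.
have -> : A_ j = \bigcap_n ~` ([set w | move_time xi n w <= T%:R] `&` (X n @^-1` [set j])).
  apply/seteqP; split=> w /= Aw.
    by move=> n _ [tT Xn]; apply: Aw; exists n.
  by move=> [n [tT Xn]]; apply: (Aw n I); split.
apply: bigcap_measurableType => n _; apply: measurableC; apply: measurableI.
  exact: measurable_move_time_le.
by rewrite -[X in measurable X]setTI; exact: measurable_funPT.
Qed.

(** The starting vertex v_1 is always visited, so the unvisited vertices are counted from v_2 on. *)
Lemma num_visitedE : num_visited k0 xi X T =1
  (cst (k0 + T)%:R \- (\sum_(2 <= j < (k0 + T).+1) \1_(A_ j) : Omega -> R)).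
Proof.
move=> w; rewrite /num_visited /vertices natrK /index_iota.
rewrite (_ : (k0 + T = (k0 + T).-1.+1)%N); last by lia.
rewrite /= fct_sumE subSS subn1 /=.
have -> : `[< visited xi X T%:R 1 w >].
  by apply/asboolP; exists 0%N; rewrite (walk_start walk) /move_time big_ord0.
rewrite -[in (_.-1.+1)%:R](size_iota 2 (k0 + T).-1).
elim: (iota _ _) => [|j s IH]; first by rewrite big_nil subr0.
have AE : (w \in A_ j) = ~~ `[< visited xi X T%:R j w >] by exact: asbool_neg.
rewrite /= big_cons indicE AE.
move: IH; case: `[< visited xi X T%:R j w >]; rewrite /= ?add0n ?add1n ?add0r => IH.
  by rewrite -[in LHS]natr1 IH -[in RHS]natr1; ring.
by rewrite -[in RHS]natr1 IH; ring.
Qed.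

(** The vertex created at time T is almost surely not visited up to T. Its term in the variance is
    therefore 0, and the sum may stop at k0 + T - 1. *)
Lemma visit_prob_last : visit_prob k0 lambda T (k0 + T) = 0.
Proof.
rewrite visit_probE// sum_hit_prob1// (maxn_idPl _) ?leq_addr//.
by rewrite subrr mulr0 oppr0 expR0 subrr.
Qed.

Lemma variance_num_visited :
  ('V_P[num_visited k0 xi X T])%E = (\sum_(2 <= j < k0 + T)
     (1 - visit_prob k0 lambda T j) * visit_prob k0 lambda T j)%:E.
Proof.
have jin j : j \in index_iota 2 (k0 + T).+1 = (2 <= j <= k0 + T)%N.
  by rewrite mem_index_iota.
rewrite (funext num_visitedE) varianceB_cst_l; last first.
  by apply: Lfun2_sum_indic => j _; exact: measurable_unvisited.
rewrite variance_sum_indic; last 3 first.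
- exact: iota_uniq.
- by move=> j _; exact: measurable_unvisited.
- move=> r s; rewrite !jin => /andP[r2 rT] /andP[s2 sT] rs.
  exact: prob_unvisited2.
transitivity (\sum_(2 <= j < (k0 + T).+1)
     (1 - visit_prob k0 lambda T j) * visit_prob k0 lambda T j)%:E.
  rewrite -sumEFin; apply: eq_big_seq => j; rewrite jin => /andP[j2 jT].
  by rewrite prob_unvisited1// -EFinM -EFinB; congr EFin; ring.
by rewrite big_nat_recr/= ?visit_prob_last ?mulr0 ?addr0//; lia.
Qed.

End unvisited.

(** * Asymptotics of the variance *)

Section asymptotics.
Variables (R : realType) (k0 : nat).
Hypothesis k0_ge3 : (3 <= k0)%N.

Definition unvisited_sum (mu : R) (T : nat) : R :=
  \sum_(2 <= j < (k0 + T).+1) (1 - visit_prob k0 mu T j).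

Lemma unvisited_sum0 mu : unvisited_sum mu 0 = k0.-1%:R.
Proof.
rewrite /unvisited_sum addn0 (eq_big_nat _ _ (F2 := fun=> 1)).
  by rewrite big_const_nat iter_addr_0 subSS subn1.
move=> j /andP[_ jk]; rewrite visit_probE//; last by lia.
by rewrite big_ord0 mulr0 oppr0 expR0 subrr subr0.
Qed.

(** One more unit of time multiplies every 1 - u_j by the same exponential, and the newly created
    vertex adds 1. *)
Lemma unvisited_sumS mu T : unvisited_sum mu T.+1 =
  expR (- (mu / (k0 + T).-1%:R)) * unvisited_sum mu T + 1.
Proof.
rewrite /unvisited_sum big_nat_recr/=; last by lia.
rewrite (visit_prob_last _ k0_ge3) subr0; congr (_ + _).
rewrite addnS big_distrr/=; apply: eq_big_nat => j /andP[_ jT].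
rewrite !visit_probE//; [|lia..].
rewrite big_ord_recr/= !opprB ![1 + _]addrC !subrK -expRD; congr expR.
have jT' : (j <= k0 + T)%N := jT.
have -> : hit_prob R k0 [:: j] T = (k0 + T).-1%:R^-1.
  by rewrite /hit_prob/= jT' mul1r.
by ring.
Qed.

(** Write (1 - u) * u as (1 - u) - (1 - u)^2; squaring the exponential 1 - u doubles the rate. *)
Lemma variance_unvisited_sum (lambda : R) (T : nat) :
  \sum_(2 <= j < k0 + T) (1 - visit_prob k0 lambda T j) * visit_prob k0 lambda T j
  = unvisited_sum lambda T - unvisited_sum (2 * lambda) T.
Proof.
rewrite /unvisited_sum -sumrB [in RHS]big_nat_recr/=; last by lia.
rewrite !(visit_prob_last _ k0_ge3) subrr addr0; apply: eq_big_nat => j /andP[_ jT].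
rewrite !visit_probE//; [|lia..].
set s := \sum_(k < T) _.
have -> : - (2 * lambda * s) = - (lambda * s) + - (lambda * s) by ring.
by rewrite expRD; ring.
Qed.

(* With D_T = B_T - n/(mu+1), B_T = unvisited_sum mu T and n = k0+T-1, the recursion for B_T
   gives D_{T+1} = exp(-mu/n) D_T + eps, where (mu+1) eps is the quantity bounded here. *)
Lemma unvisited_sum_drift (mu : R) (n : nat) : 0 < mu -> (0 < n)%N ->
  0 <= mu - n%:R * (1 - expR (- (mu / n%:R))) <= mu * (mu / n%:R).
Proof.
move=> mu0 n0; have n0' : 0 < n%:R :> R by rewrite ltr0n.
set x := mu / n%:R; have x0 : 0 < x by rewrite divr_gt0.
(* With x = mu/n, both bounds follow from 1 - x <= exp(-x) <= 1/(1 + x) <= 1 - x + x^2. *)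
have muE : mu = n%:R * x by rewrite /x mulrC divfK// gt_eqF.
have e1 : 1 - x <= expR (- x) := expR_ge1Dx (- x).
have e2 : expR (- x) <= (1 + x)^-1.
  by rewrite expRN lef_pV2 ?posrE ?expR_gt0 ?expR_ge1Dx//; lra.
have e3 : (1 + x)^-1 <= 1 - x + x * x.
  rewrite -[leLHS]mul1r ler_pdivrMr; last by lra.
  have := mulr_ge0 (mulr_ge0 (ltW x0) (ltW x0)) (ltW x0); lra.
apply/andP; split.
  by rewrite subr_ge0 [leRHS]muE ler_pM2l//; lra.
by rewrite [X in X - _]muE -mulrBr [X in _ <= X * _]muE -mulrA ler_pM2l//; lra.
Qed.

(** By induction: the initial error is at most k0, the recursion multiplies the error by a factor at
    most 1, and step T adds at most mu/(T + 1). *)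
Lemma unvisited_sum_error (mu : R) (T : nat) : 0 < mu ->
  `|unvisited_sum mu T - (k0 + T).-1%:R / (mu + 1)|
  <= k0%:R + mu * series harmonic T.
Proof.
move=> mu0; have mu1 : 0 < mu + 1 by lra.
elim: T => [|T IH].
  rewrite unvisited_sum0 addn0 /series/= big_geq// mulr0 addr0.
  have c0 : 0 <= k0.-1%:R :> R by [].
  have c1 : k0.-1%:R <= k0%:R :> R by rewrite ler_nat leq_pred.
  have d0 : 0 <= k0.-1%:R / (mu + 1) by rewrite divr_ge0// ltW.
  have d1 : k0.-1%:R / (mu + 1) <= k0.-1%:R.
    rewrite ler_pdivrMr// ler_peMr//; lra.
  by rewrite ger0_norm; lra.
rewrite unvisited_sumS seriesSr mulrDr addrA.
set n := (k0 + T).-1; have n0 : (0 < n)%N by rewrite /n; lia.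
have -> : (k0 + T.+1).-1 = n.+1 by rewrite /n; lia.
have n0' : 0 < n%:R :> R by rewrite ltr0n.
set e := expR _; set B := unvisited_sum mu T in IH *.
pose eps := (mu - n%:R * (1 - e)) / (mu + 1).
have -> : e * B + 1 - n.+1%:R / (mu + 1) = e * (B - n%:R / (mu + 1)) + eps.
  by rewrite /eps -natr1; field; rewrite gt_eqF.
have [eps0 eps1] : 0 <= eps /\ eps <= mu * harmonic T.
  have /andP[h0 h1] := unvisited_sum_drift mu0 n0.
  split; first by rewrite divr_ge0// ltW.
  rewrite ler_pdivrMr//; apply: (le_trans h1); rewrite -mulrA ler_pM2l//.
  apply: (@le_trans _ _ (mu * harmonic T)); last first.
    by rewrite mulrC ler_pM2l ?invr_gt0// lerDl.
  by rewrite /harmonic/= ler_pM2l// lef_pV2 ?posrE// ler_nat /n; lia.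
apply: le_trans (ler_normD _ _) _; apply: lerD; last by rewrite ger0_norm.
apply: le_trans IH; rewrite normrM ger0_norm ?expR_ge0// ler_piMl//.
by rewrite /e -[leRHS]expR0 ler_expR oppr_le0 divr_ge0// ltW.
Qed.

Lemma unvisited_sum_cvg (mu : R) : 0 < mu ->
  unvisited_sum mu T / T%:R @[T --> \oo] --> (mu + 1)^-1.
Proof.
move=> mu0; rewrite -cvg_shiftS/=; have mu1 : 0 < mu + 1 by lra.
(* The first term collects the initial error k0 and the shift between k0 + n and n + 1. The second
   is the averaged harmonic sum, which tends to 0 by Cesaro's theorem. *)
pose err (n : nat) : R := (k0%:R + k0%:R / (mu + 1)) * harmonic n + mu * arithmetic_mean harmonic n.
have err0 : err n @[n --> \oo] --> 0.
  rewrite -[X in _ --> X](_ : (k0%:R + k0%:R / (mu + 1)) * 0 + mu * 0 = 0); last by ring.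
  apply: cvgD; apply: cvgMl_tmp; first exact: cvg_harmonic.
  exact: cesaro cvg_harmonic.
apply/cvgrPdist_le => /= eps eps0; near=> n.
have errn : err n <= eps.
  apply: le_trans (ler_norm _) _; near: n.
  by move/cvgr0Pnorm_le : err0; apply.
apply: le_trans errn.
have := unvisited_sum_error n.+1 mu0.
rewrite addnS /=; set B := unvisited_sum _ _; set h := series _ _ => hB.
have n1 : 0 < n.+1%:R :> R by rewrite ltr0n.
have -> : (mu + 1)^-1 - B / n.+1%:R =
    - ((B - (k0 + n)%:R / (mu + 1)) / n.+1%:R) - (k0%:R - 1) / (mu + 1) * harmonic n.
  by rewrite /harmonic/= natrD -natr1; field; rewrite natr1 !gt_eqF.
apply: le_trans (ler_normB _ _) _; rewrite normrN !normrM.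
have k1 : 1 <= k0%:R :> R by rewrite ler1n; lia.
rewrite (@ger0_norm _ (k0%:R - 1)); last by lra.
rewrite (@ger0_norm _ (mu + 1)^-1) ?invr_ge0 ?(ltW mu1)// (@ger0_norm _ (harmonic n)) ?invr_ge0//.
apply: (@le_trans _ _ ((k0%:R + mu * h) / n.+1%:R + k0%:R / (mu + 1) * harmonic n)).
  apply: lerD; rewrite ?ler_pM2r ?invr_gt0//.
  by rewrite ?ler_pM2r ?invr_gt0//; lra.
by rewrite /err /arithmetic_mean /harmonic/= -/h le_eqVlt; apply/orP; left; apply/eqP; ring.
Unshelve. all: end_near. Qed.

End asymptotics.

Theorem theorem2p2 (d : measure_display) (Omega : measurableType d)
    (R : realType) (P : probability Omega R) (k0 : nat) (lambda : R)
    (xi : nat -> {RV P >-> R}) (X : nat -> {RV P >-> nat}) :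
  (3 <= k0)%N -> 0 < lambda ->
  growing_complete_walk k0 xi X lambda ->
  [/\ forall T : nat, (1 <= T)%N ->
        forall r s : nat, (2 <= r)%N -> (r < s)%N -> (s <= k0 + T - 1)%N ->
        independent_events P (unvisited xi X T r) (unvisited xi X T s),
      forall T : nat, (1 <= T)%N ->
        ('V_P[num_visited k0 xi X T])%E
          = (\sum_(2 <= j < k0 + T)
              (1 - visit_prob k0 lambda T j) * visit_prob k0 lambda T j)%:E
    & (fun T : nat => fine ('V_P[num_visited k0 xi X T])%E
          / (lambda / ((lambda + 1) * (2 * lambda + 1)) * T%:R)) @ \oo
        --> (1 : R)].
Proof.
move=> k0_ge3 lambda0 walk; split.
- move=> T T1 r s r2 rs sT; apply: (prob_unvisited2 k0_ge3 lambda0 walk) => //; lia.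
- by move=> T _; rewrite (variance_num_visited k0_ge3 lambda0 walk).
under eq_fun do rewrite (variance_num_visited k0_ge3 lambda0 walk) (variance_unvisited_sum k0_ge3).
set c := lambda / _.
have c0 : c != 0 by rewrite gt_eqF// divr_gt0// mulr_gt0; lra.
have -> : (fun T : nat => fine (unvisited_sum k0 lambda T - unvisited_sum k0 (2 * lambda) T)%:E / (c * T%:R))
    = (fun T : nat => c^-1 * (unvisited_sum k0 lambda T / T%:R - unvisited_sum k0 (2 * lambda) T / T%:R)).
  apply/funext => T /=; rewrite invfM; ring.
(* The limits of the two sums, at rates lambda and 2 * lambda, differ exactly by [c]. *)
have c1 : c^-1 * ((lambda + 1)^-1 - (2 * lambda + 1)^-1) = 1.
  by rewrite /c; field; rewrite !gt_eqF//; lra.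
have l20 : 0 < 2 * lambda by lra.
have := cvgMl_tmp (a := c^-1)
  (cvgB (unvisited_sum_cvg k0_ge3 lambda0) (unvisited_sum_cvg k0_ge3 l20)).
rewrite c1 => H; exact: H.
Qed.
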